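(* Let $R$ be a commutative ring and let $a,b,c\in R$ be such that $aR+2bR+cR=R$. Put $D=b^2-ac$ and $A=R[T]/(T^2-D)$. Let $L=R^2$, equipped with the $A$-module structure for which the class of $T$ acts on $L$ as the $R$-linear endomorphism $f$ with matrix $$f=\begin{pmatrix}-b & -c\\ a & b\end{pmatrix}$$ (which satisfies $f^2=D$). Then the $A$-module $L$ is invertible.
   Context: $L$ is the module attached to the binary quadratic form $aX^2+2bXY+cY^2$ over $R$. For a commutative ring $A$, an $A$-module is called invertible if it is projective, finitely generated and of rank $1$. Here a finitely generated $A$-module $L$ has rank $n$ if for every prime ideal $\mathfrak{p}$ of $A$, with $\kappa(\mathfrak{p})$ the fraction field of $A/\mathfrak{p}$, the $\kappa(\mathfrak p)$-vector space $(L/\mathfrak{p}L)_{\mathfrak{p}}=\kappa(\mathfrak{p})\otimes_A L$ has dimension $n$. *)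

(* Defs.v *)
From HB Require Import structures.
From mathcomp Require Import all_boot all_order all_algebra.
From mathcomp Require Import boolp.

Set Implicit Arguments.
Unset Strict Implicit.
Unset Printing Implicit Defensive.

Import GRing.Theory.
Local Open Scope ring_scope.
Local Open Scope quotient_scope.

(* The tensor product [K (x)_A L], for [K] an [A]-algebra via [phi]: finite
   formal sums of pairs, modulo the congruence generated by biadditivity and
   [A]-balancedness.  The class [tensor_0] is needed because formal sums are
   only a monoid: it identifies [0 (x) 0] with the empty sum. *)
Section BaseChange.
Variables (A K : comNzRingType) (phi : {rmorphism A -> K}) (L : lmodType A).

Inductive tensor_eq : seq (K * L) -> seq (K * L) -> Prop :=
| tensor_refl s : tensor_eq s s
| tensor_sym s t : tensor_eq s t -> tensor_eq t s
| tensor_trans s t u : tensor_eq s t -> tensor_eq t u -> tensor_eq s u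
| tensor_cat s s' t t' :
    tensor_eq s s' -> tensor_eq t t' -> tensor_eq (s ++ t) (s' ++ t')
| tensor_catC s t : tensor_eq (s ++ t) (t ++ s)
| tensor_Dl k k' x : tensor_eq [:: (k + k', x)] [:: (k, x); (k', x)]
| tensor_Dr k x y : tensor_eq [:: (k, x + y)] [:: (k, x); (k, y)]
| tensor_mid k a x : tensor_eq [:: (k * phi a, x)] [:: (k, a *: x)]
| tensor_0 : tensor_eq [:: (0, 0)] [::].

Definition tensor_eqb (s t : seq (K * L)) : bool := `[< tensor_eq s t >].

Lemma tensor_eqb_equiv : equiv_class_of tensor_eqb.
Proof.
split=> [s|s t|t s u]; first exact/asboolP/tensor_refl.
  by apply/asboolP/asboolP; apply: tensor_sym.
by move=> /asboolP st /asboolP tu; apply/asboolP/(tensor_trans st tu).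
Qed.

Canonical tensor_equiv := EquivRelPack tensor_eqb_equiv.

Definition base_change := {eq_quot tensor_equiv}.
HB.instance Definition _ := Choice.on base_change.
HB.instance Definition _ := EqQuotient.on base_change.

Definition tensor_sum (s : seq (K * L)) : base_change := \pi_base_change s.

Lemma tensor_sumP s t : tensor_sum s = tensor_sum t <-> tensor_eq s t.
Proof. by split=> [/eqmodP/asboolP|st] //; apply/eqmodP/asboolP. Qed.

Lemma tensor_repr (u : base_change) : tensor_sum (repr u) = u.
Proof. exact: reprK. Qed.

Definition scale_sum (k : K) (s : seq (K * L)) := [seq (k * u.1, u.2) | u <- s].

Lemma tensor_0l x : tensor_eq [:: (0, x)] [::].
Proof.
rewrite -[X in (X, x)](mul0r (phi 0)).
by apply: tensor_trans (tensor_mid _ _ _) _; rewrite scale0r; apply: tensor_0.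
Qed.

Lemma scale_sum_eq k s t :
  tensor_eq s t -> tensor_eq (scale_sum k s) (scale_sum k t).
Proof.
elim=> {s t} [s|s t _|s t u _ st _|s s' t t' _ ss _ tt|s t|k1 k2 x|k1 x y|k1 a x|].
- exact: tensor_refl.
- exact: tensor_sym.
- exact: tensor_trans.
- by rewrite /scale_sum !map_cat; apply: tensor_cat.
- by rewrite /scale_sum !map_cat; apply: tensor_catC.
- by rewrite /= mulrDr; apply: tensor_Dl.
- exact: tensor_Dr.
- by rewrite /= mulrA; apply: tensor_mid.
- by rewrite /= mulr0; apply: tensor_0.
Qed.

Definition bc_add (u v : base_change) := tensor_sum (repr u ++ repr v).
Definition bc_scale (k : K) (u : base_change) := tensor_sum (scale_sum k (repr u)).
Definition bc_opp (u : base_change) := bc_scale (-1) u.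
Definition bc_zero := tensor_sum [::].

Lemma bc_addE s t : bc_add (tensor_sum s) (tensor_sum t) = tensor_sum (s ++ t).
Proof.
by apply/tensor_sumP/tensor_cat; apply/tensor_sumP; rewrite tensor_repr.
Qed.

Lemma bc_scaleE k s : bc_scale k (tensor_sum s) = tensor_sum (scale_sum k s).
Proof.
by apply/tensor_sumP/scale_sum_eq; apply/tensor_sumP; rewrite tensor_repr.
Qed.

Lemma base_change_ind (P : base_change -> Prop) :
  (forall s, P (tensor_sum s)) -> forall u, P u.
Proof. by move=> Ps u; rewrite -(tensor_repr u). Qed.

Lemma bc_addA : associative bc_add.
Proof.
by do 3!elim/base_change_ind=> ?; rewrite !bc_addE catA.
Qed.

Lemma bc_addC : commutative bc_add.
Proof.
by do 2!elim/base_change_ind=> ?; rewrite !bc_addE; apply/tensor_sumP/tensor_catC.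
Qed.

Lemma bc_add0 : left_id bc_zero bc_add.
Proof. by elim/base_change_ind=> s; rewrite bc_addE. Qed.

Lemma bc_scaleDl u : {morph bc_scale^~ u : k l / k + l >-> bc_add k l}.
Proof.
elim/base_change_ind: u => s k l; rewrite !bc_scaleE bc_addE.
apply/tensor_sumP; elim: s => [|[m x] s IHs] /=; first exact: tensor_refl.
apply: (@tensor_trans _
  ([:: (k * m, x); (l * m, x)] ++ (scale_sum k s ++ scale_sum l s))).
  by rewrite -cat1s mulrDl; apply: tensor_cat; [apply: tensor_Dl|].
apply: (@tensor_cat [:: (k * m, x)] [:: (k * m, x)]
         ((l * m, x) :: scale_sum k s ++ scale_sum l s)
         (scale_sum k s ++ [:: (l * m, x)] ++ scale_sum l s)).
  exact: tensor_refl.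
rewrite catA.
exact: (tensor_cat (tensor_catC [:: (l * m, x)] _) (tensor_refl _)).
Qed.

Lemma bc_scale0 u : bc_scale 0 u = bc_zero.
Proof.
elim/base_change_ind: u => s; rewrite bc_scaleE; apply/tensor_sumP.
elim: s => [|[m x] s IHs] /=; first exact: tensor_refl.
by rewrite -cat1s -[[::]]cat0s mul0r; apply: tensor_cat (tensor_0l _) IHs.
Qed.

Lemma bc_scale1 : left_id 1 bc_scale.
Proof.
elim/base_change_ind=> s; rewrite bc_scaleE /scale_sum; congr tensor_sum.
by elim: s => [|[k x] s IHs] //=; rewrite mul1r IHs.
Qed.

Lemma bc_addN : left_inverse bc_zero bc_opp bc_add.
Proof.
move=> u; rewrite /bc_opp -{2}(bc_scale1 u) -bc_scaleDl addNr.
exact: bc_scale0.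
Qed.

Lemma bc_scaleA k l u : bc_scale k (bc_scale l u) = bc_scale (k * l) u.
Proof.
elim/base_change_ind: u => s; rewrite !bc_scaleE /scale_sum -map_comp.
by congr tensor_sum; apply: eq_map => v /=; rewrite mulrA.
Qed.

Lemma bc_scaleDr : right_distributive bc_scale bc_add.
Proof.
move=> k; do 2!elim/base_change_ind=> ?.
by rewrite !(bc_scaleE, bc_addE) /scale_sum map_cat.
Qed.

HB.instance Definition _ :=
  GRing.isZmodule.Build base_change bc_addA bc_addC bc_add0 bc_addN.
HB.instance Definition _ :=
  GRing.Zmodule_isLmodule.Build K base_change
    bc_scaleA bc_scale1 bc_scaleDr bc_scaleDl.

Definition tensor (k : K) (x : L) : base_change := tensor_sum [:: (k, x)].

Lemma tensorDl k l x : tensor (k + l) x = tensor k x + tensor l x.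
Proof. by rewrite [RHS]bc_addE; apply/tensor_sumP/tensor_Dl. Qed.

Lemma tensorDr k x y : tensor k (x + y) = tensor k x + tensor k y.
Proof. by rewrite [RHS]bc_addE; apply/tensor_sumP/tensor_Dr. Qed.

Lemma tensor_balanced k a x : tensor (k * phi a) x = tensor k (a *: x).
Proof. exact/tensor_sumP/tensor_mid. Qed.

Lemma tensorZ k l x : k *: tensor l x = tensor (k * l) x.
Proof. exact: bc_scaleE. Qed.

Lemma tensor_sumE s : tensor_sum s = \sum_(u <- s) tensor u.1 u.2.
Proof.
elim: s => [|[k x] s IHs]; first by rewrite big_nil.
by rewrite big_cons -IHs [RHS]bc_addE.
Qed.

Lemma base_change_universal (W : lmodType K) (h : L -> W) :
    (forall x y, h (x + y) = h x + h y) ->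
    (forall a x, h (a *: x) = phi a *: h x) ->
  exists2 g : {linear base_change -> W},
    (forall x, g (tensor 1 x) = h x) &
    forall g' : {linear base_change -> W},
      (forall x, g' (tensor 1 x) = h x) -> g' =1 g.
Proof.
move=> hD hZ; pose ev (s : seq (K * L)) : W := \sum_(u <- s) u.1 *: h u.2.
have ev_eq s t : tensor_eq s t -> ev s = ev t.
  elim=> {s t} [//|//|s t u _ -> _ -> //|s s' t t' _ es _ et|s t|k1 k2 x|k1 x y|k1 a x|].
  - by move: es et; rewrite /ev !big_cat /= => -> ->.
  - by rewrite /ev !big_cat /= addrC.
  - by rewrite /ev !big_cons !big_nil /= !addr0 scalerDl.
  - by rewrite /ev !big_cons !big_nil /= !addr0 hD scalerDr.
  - by rewrite /ev !big_cons !big_nil /= !addr0 hZ scalerA.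
  - by rewrite /ev big_cons !big_nil /= scale0r addr0.
pose g0 (u : base_change) := ev (repr u).
have g0E s : g0 (tensor_sum s) = ev s.
  by apply: ev_eq; apply/tensor_sumP; rewrite tensor_repr.
have g0_lin : linear g0.
  move=> k u v; elim/base_change_ind: u => s; elim/base_change_ind: v => t.
  rewrite [X in g0 (X + _)]bc_scaleE [X in g0 X]bc_addE !g0E /ev big_cat /=.
  rewrite big_map scaler_sumr; congr (_ + _); apply: eq_bigr => u _ /=.
  by rewrite scalerA.
pose g0L := GRing.isLinear.Build K base_change W *:%R g0 g0_lin.
pose g : {linear base_change -> W} := HB.pack g0 g0L.
exists g => [x|g' g'E]; first by rewrite /= g0E /ev big_seq1 scale1r.
elim/base_change_ind=> s; rewrite /= g0E tensor_sumE linear_sum /=.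
apply: eq_bigr => -[k x] _ /=.
by rewrite -[k in tensor k x]mulr1 -tensorZ linearZ /= g'E.
Qed.

End BaseChange.

(* The residue ring [A / p], as an integral domain.  Boolean predicates lose no
   generality for [p]: every subset of [A] is one, classically. *)
Section ResidueField.
Variables (A : comNzRingType) (p : prime_idealr A).

Definition residue_ring := {ideal_quot p}.
HB.instance Definition _ := GRing.ComNzRing.on residue_ring.

Definition residue_unit : pred residue_ring := fun x => `[< exists y, y * x = 1 >].

Definition residue_inv (x : residue_ring) : residue_ring :=
  if pselect (exists y, y * x = 1) is left e then projT1 (cid e) else x.

Lemma residue_mulVr : {in residue_unit, left_inverse 1 residue_inv *%R}.
Proof.
move=> x /asboolP xU; rewrite /residue_inv; case: pselect => // e.
exact: projT2 (cid e).
Qed.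

Lemma residue_unitP x y : y * x = 1 -> residue_unit x.
Proof. by move=> yx1; apply/asboolP; exists y. Qed.

Lemma residue_inv_out : {in [predC residue_unit], residue_inv =1 id}.
Proof.
by move=> x /asboolPn xU; rewrite /residue_inv; case: pselect.
Qed.

HB.instance Definition _ := GRing.ComNzRing_hasMulInverse.Build residue_ring
  residue_mulVr residue_unitP residue_inv_out.
HB.instance Definition _ := GRing.ComUnitRing_isIntegral.Build residue_ring
  (@Quotient.rquot_IdomainAxiom A p).

Definition residue_field : fieldType := {fraction residue_ring}.

Definition residue_map (x : A) : residue_field :=
  tofrac (\pi_{ideal_quot p} x : residue_ring).

Lemma residue_map_is_zmod_morphism : zmod_morphism residue_map.
Proof.
move=> x y; rewrite [RHS](esym (tofracB _ _)); congr (tofrac _).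
exact: (@pi_is_zmod_morphism A _ _ {ideal_quot p}).
Qed.

Lemma residue_map_is_monoid_morphism : monoid_morphism residue_map.
Proof.
have [pi1 piM] := @pi_is_monoid_morphism A _ _ {ideal_quot p}.
split=> [|x y]; first by rewrite /residue_map pi1; exact: tofrac1.
by rewrite /residue_map piM; exact: tofracM.
Qed.

HB.instance Definition _ :=
  GRing.isZmodMorphism.Build A residue_field residue_map
    residue_map_is_zmod_morphism.
HB.instance Definition _ :=
  GRing.isMonoidMorphism.Build A residue_field residue_map
    residue_map_is_monoid_morphism.

End ResidueField.

Section Invertible.
Variable A : comNzRingType.

Definition finitely_generated (L : lmodType A) : Prop :=
  exists n (e : 'I_n -> L),
    forall x, exists k : 'I_n -> A, x = \sum_(i < n) k i *: e i.

Definition projective (L : lmodType A) : Prop :=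
  forall (M N : lmodType A) (g : {linear M -> N}) (h : {linear L -> N}),
    (forall y, exists x, g x = y) ->
  exists h' : {linear L -> M}, forall x, g (h' x) = h x.

(* [Vector.axiom n V] says that [V] is linearly isomorphic to ['rV_n]. *)
Definition has_rank (n : nat) (L : lmodType A) : Prop :=
  forall p : prime_idealr A,
    inhabited (Vector.axiom n (base_change (@residue_map A p) L)).

Definition invertible_module (L : lmodType A) : Prop :=
  [/\ projective L, finitely_generated L & has_rank 1 L].

End Invertible.

(* [R[T] / (T^2 - D)], where ['qX] is the class of [T].  The library's [qpoly h]
   falls back to the modulus ['X] when [h] is not monic of positive degree;
   [mk_monic_quad] below shows that this does not happen here. *)
Definition quad_ring (R : comNzRingType) (D : R) : comNzRingType :=
  {poly %/ 'X^2 - D%:P}.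

(* [R^2], on which the class of a polynomial [q] acts as [q(form_mx)]; the
   unused arguments select this module structure. *)
Definition form_module (R : comNzRingType) (a b c : R) : Type := 'cV[R]_2.

Section FormModule.
Variables (R : comNzRingType) (a b c : R).

Local Notation form_module := (form_module a b c).

Definition form_disc : R := b ^+ 2 - a * c.

Definition form_mx : 'M[R]_2 :=
  \matrix_(i, j) nth 0 (nth [::] [:: [:: - b; - c]; [:: a; b]] i) j.

Lemma form_mx_sq : form_mx ^+ 2 = form_disc%:M.
Proof.
apply/matrixP=> i j; rewrite expr2 mxE !big_ord_recl big_ord0 !mxE /=.
rewrite /form_disc -val_eqE.
case: i => [[|[|i]]] // Hi; case: j => [[|[|j]]] // Hj /=.
- by rewrite mulrNN mulNr [c * a]mulrC addr0 expr2 mulr1n.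
- by rewrite mulrNN mulNr [c * b]mulrC addr0 subrr mulr0n.
- by rewrite mulrN [b * a]mulrC addr0 addNr mulr0n.
- by rewrite mulrN addr0 addrC expr2 mulr1n.
Qed.

Lemma monic_quad : 'X^2 - form_disc%:P \is monic.
Proof. exact: monicXnsubC. Qed.

Lemma mk_monic_quad : mk_monic ('X^2 - form_disc%:P) = 'X^2 - form_disc%:P.
Proof. by rewrite /mk_monic size_XnsubC // monic_quad. Qed.

HB.instance Definition _ := GRing.Zmodule.copy form_module 'cV[R]_2.

Definition form_scale (q : quad_ring form_disc) (v : form_module) : form_module :=
  horner_mx form_mx (val q) *m v.

Lemma horner_form_mod q :
  horner_mx form_mx (val (in_qpoly ('X^2 - form_disc%:P) q)) =
  horner_mx form_mx q.
Proof.
have h0 : horner_mx form_mx ('X^2 - form_disc%:P) = 0.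
  by rewrite rmorphB /= rmorphXn /= horner_mx_X horner_mx_C form_mx_sq subrr.
rewrite /= mk_monic_quad {2}(Pdiv.RingMonic.rdivp_eq monic_quad q).
rewrite [RHS]rmorphD [X in _ = X + _]rmorphM /=.
by rewrite [X in _ * X]h0 mulr0 add0r.
Qed.

Lemma form_scaleA q r v : form_scale q (form_scale r v) = form_scale (q * r) v.
Proof. by rewrite /form_scale horner_form_mod rmorphM /= mulmxA. Qed.

Lemma form_scale1 : left_id 1 form_scale.
Proof. by move=> v; rewrite /form_scale rmorph1 mul1mx. Qed.

Lemma form_scaleDr : right_distributive form_scale +%R.
Proof. by move=> q u v; rewrite /form_scale mulmxDr. Qed.

Lemma form_scaleDl v : {morph form_scale^~ v : q r / q + r}.
Proof. by move=> q r; rewrite /form_scale rmorphD mulmxDl. Qed.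

HB.instance Definition _ :=
  GRing.Zmodule_isLmodule.Build (quad_ring form_disc) form_module
    form_scaleA form_scale1 form_scaleDr form_scaleDl.

Lemma form_scale_T (v : form_module) :
  ('qX : quad_ring form_disc) *: v = form_mx *m v.
Proof.
by rewrite [LHS](_ : _ = form_scale 'qX v) // /form_scale horner_form_mod horner_mx_X.
Qed.

Lemma form_scale_C (r : R) (v : form_module) :
  (qpolyC _ r : quad_ring form_disc) *: v = r *: (v : 'cV[R]_2).
Proof.
rewrite [LHS](_ : _ = form_scale (qpolyC _ r) v) //.
by rewrite /form_scale /= horner_mx_C mul_scalar_mx.
Qed.

End FormModule.

(* Main.v *)
(* Write Q for the form, f for the action of T on L = R^2, and det(w, v) for the
   standard symplectic form.  For w in L the map
     alpha_w(v) = det(w, v) T + det(w, f v)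
   is A-linear from L to A, and satisfies alpha_w(w) = Q(w) and
   alpha_w(v) w = Q(w) v.  The values of Q at (1, 0), (0, 1) and (1, 1) are a, c
   and a + 2b + c, which generate the unit ideal; hence a combination of the
   alpha_w(v) w is v, which is a finite dual basis of L.  Over a residue field
   one of these three values is invertible, and there alpha_w / Q(w) is an
   isomorphism with inverse k |-> k (x) w. *)
From HB Require Import structures.
Require Import Defs.
From mathcomp Require Import all_boot all_order all_algebra.
From mathcomp Require Import boolp ring.

Set Implicit Arguments.
Unset Strict Implicit.
Unset Printing Implicit Defensive.

Import GRing.Theory.
Local Open Scope ring_scope.

Section ReproducingPairs.
Variables (A : comNzRingType) (L : lmodType A).

Lemma base_change_line (K : fieldType) (phi : {rmorphism A -> K})
    (alpha : {linear L -> A^o}) (w : L) :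
    (forall v, alpha v *: w = alpha w *: v) -> phi (alpha w) != 0 ->
  Vector.axiom 1 (base_change phi L).
Proof.
move=> alphaE sN0; set s := phi (alpha w) in sN0.
pose h (v : L) : 'rV[K]_1 := const_mx (phi (alpha v) / s).
have hD x y : h (x + y) = h x + h y.
  by apply/rowP=> j; rewrite !mxE raddfD rmorphD mulrDl.
have hZ t x : h (t *: x) = phi t *: h x.
  by apply/rowP=> j; rewrite !mxE linearZ /= rmorphM mulrA.
have [g gE _] := cid2 (base_change_universal hD hZ).
have gT k x : g (tensor phi k x) = k *: h x.
  by rewrite -[k in tensor _ k]mulr1 -tensorZ linearZ /= gE.
pose g' (r : 'rV[K]_1) := tensor phi (r 0 0) w.
suff gK : cancel g g'.
  exists g; first exact: linearP.
  exists g' => // r.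
  by apply/rowP=> j; rewrite gT !mxE -/s divff // mulr1 [j]ord1.
elim/base_change_ind=> t; rewrite /g' tensor_sumE linear_sum /= summxE.
elim: t => [|[k x] t IHt].
  by rewrite !big_nil -[0 in LHS](mul0r 0) -tensorZ scale0r.
rewrite !big_cons tensorDl IHt; congr (_ + _).
(* The scalar [alpha x] crosses the tensor sign, where [alpha x *: w = alpha w *: x]; then [s]
   crosses back and cancels the division. *)
rewrite gT /= !mxE mulrA -mulrAC tensor_balanced alphaE -tensor_balanced -/s.
by rewrite divfK.
Qed.

Variables (n : nat) (k : 'I_n -> A) (w : 'I_n -> L).
Variable alpha : 'I_n -> {linear L -> A^o}.
Hypothesis alphaE : forall i v, alpha i v *: w i = alpha i (w i) *: v.
Hypothesis alpha1 : \sum_(i < n) k i * alpha i (w i) = 1.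

Lemma dual_basis v : v = \sum_(i < n) (k i * alpha i v) *: w i.
Proof.
rewrite -[LHS]scale1r -alpha1 scaler_suml.
by apply: eq_bigr => i _; rewrite -!scalerA alphaE.
Qed.

Lemma invertible_of_pairs : invertible_module L.
Proof.
split=> [M N g h g_surj||p].
- have [x xE] := choice (fun i => g_surj (h (w i))).
  (* The dual-basis coordinates of [v] are placed on chosen preimages of the [h (w i)]. *)
  pose f v := \sum_(i < n) (k i * alpha i v) *: x i.
  have f_lin : linear f.
    move=> t u v; rewrite /f scaler_sumr -big_split /=.
    by apply: eq_bigr => i _; rewrite linearP /= mulrDr scalerDl scalerA mulrCA.
  pose fL := GRing.isLinear.Build A L M *:%R f f_lin.
  pose f' : {linear L -> M} := HB.pack f fL.
  exists f' => v; rewrite /= {2}(dual_basis v) !linear_sum /=.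
  by apply: eq_bigr => i _; rewrite !linearZ /= xE.
- by exists n, w => v; exists (fun i => k i * alpha i v); apply: dual_basis.
- have [i sN0] : exists i, residue_map p (alpha i (w i)) != 0.
    (* If all [alpha i (w i)] vanished in the residue field, [alpha1] would become 0 = 1 there. *)
    apply: contrapT => /forallNP s0; have /eqP[] := oner_neq0 (residue_field p).
    rewrite -(rmorph1 (@residue_map A p)) -alpha1 rmorph_sum big1 // => i _.
    by have /negP := s0 i; rewrite negbK => /eqP s0i; rewrite rmorphM /= s0i mulr0.
  exact: inhabits (base_change_line (alphaE i) sN0).
Qed.

End ReproducingPairs.

Section FormPairing.
Variables (R : comNzRingType) (a b c : R).

Local Notation L := (form_module a b c).
Local Notation A := (quad_ring (form_disc a b c)).
Local Notation modulus := ('X^2 - (form_disc a b c)%:P).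
Local Notation f := (form_mx a b c).

Definition area (w v : 'cV[R]_2) : R := w 0 0 * v 1 0 - w 1 0 * v 0 0.

(** This is the only possible A-linear map with T-coefficient [area w]: as T(pT + q) = qT + Dp, its
    constant term at v must be its T-coefficient at f v. *)
Definition pairing (w v : L) : A :=
  in_qpoly modulus (area w v *: 'X + (area w (f *m v))%:P).

Lemma form_mxE (v : 'cV[R]_2) :
  ((f *m v) 0 0 = - b * v 0 0 - c * v 1 0) *
  ((f *m v) 1 0 = a * v 0 0 + b * v 1 0).
Proof.
have ord0E : ord0 = 0 :> 'I_2 by apply: val_inj.
have lift1 : lift ord0 ord0 = 1 :> 'I_2 by apply: val_inj.
by split; rewrite !mxE !big_ord_recl !big_ord0 !mxE /= !addr0 lift1 ord0E ?mulNr.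
Qed.

Lemma in_qpoly_modulus : in_qpoly modulus modulus = 0.
Proof.
by apply: val_inj; rewrite /= mk_monic_quad Pdiv.RingMonic.rmodpp ?monic_quad.
Qed.

(** Linearity for T: since f^2 = D, passing from v to f v turns the coefficients (p, q) of pT + q
    into (q, Dp), as multiplication by T does. *)
Lemma pairing_form_mx w v :
  pairing w (f *m v) = in_qpoly modulus 'X * pairing w v.
Proof.
rewrite /pairing -in_qpolyM.
have -> : area w (f *m (f *m v)) = form_disc a b c * area w v.
  rewrite /area !form_mxE /form_disc; ring.
(* The two sides differ by the multiple [area w v] of the modulus. *)
rewrite -[LHS]addr0 -[0 in LHS](mulr0 (in_qpoly modulus (area w v)%:P)).
rewrite -in_qpoly_modulus -in_qpolyM -in_qpolyD; congr in_qpoly.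
rewrite -!mul_polyC polyCM; ring.
Qed.

Lemma pairing_linear w : linear (pairing w : L -> A^o).
Proof.
have pD : {morph pairing w : u v / u + v}.
  move=> u v; rewrite /pairing -in_qpolyD; congr in_qpoly.
  rewrite mulmxDr -!mul_polyC.
  rewrite addrACA -mulrDl -!polyCD /area !mxE; congr (_%:P * _ + _%:P); ring.
have pZ r v : pairing w (r *: (v : 'cV[R]_2)) = in_qpoly modulus r%:P * pairing w v.
  rewrite /pairing -in_qpolyM; congr in_qpoly.
  rewrite -scalemxAr -!mul_polyC mulrDr mulrA -!polyCM.
  rewrite /area !mxE; congr (_%:P * _ + _%:P); ring.
(* Horner induction extends linearity from R and T to all polynomials; it then applies to the
   reduced representative of an element of A. *)
have pP (q : {poly R}) v :
    pairing w (horner_mx f q *m v) = in_qpoly modulus q * pairing w v.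
  elim/poly_ind: q v => [|q r IHq] v.
    rewrite rmorph0 mul0mx in_qpoly0 mul0r -[0 in LHS](scale0r v) pZ.
    by rewrite in_qpoly0 mul0r.
  rewrite rmorphD rmorphM /= horner_mx_X horner_mx_C mulmxDl -mulmxA mul_scalar_mx.
  by rewrite pD IHq pZ pairing_form_mx in_qpolyD in_qpolyM mulrDl mulrA.
move=> q u v; rewrite pD; congr (_ + _).
rewrite [LHS]pP; congr (_ * _); apply: val_inj.
exact: in_qpoly_small (size_mk_monic q).
Qed.

Definition pairingL (w : L) : {linear L -> A^o} :=
  HB.pack (pairing w : L -> A^o)
    (GRing.isLinear.Build A L A^o *:%R (pairing w) (pairing_linear w)).

Lemma pairing_diag w :
  pairing w w = qpolyC modulus
    (a * w 0 0 ^+ 2 + 2 * b * (w 0 0 * w 1 0) + c * w 1 0 ^+ 2).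
Proof.
have qC r : qpolyC modulus r = in_qpoly modulus r%:P.
  apply/val_inj/esym/in_qpoly_small.
  exact: size_mk_monic (qpolyC modulus r).
rewrite qC /pairing; congr in_qpoly.
rewrite /area !form_mxE [w 1 0 * w 0 0]mulrC subrr scale0r add0r.
congr _%:P; ring.
Qed.

(** This is Cramer's relation between the vectors w, v and f w of R^2, in which det(v, f w) = det(w,
    f v) because f has trace 0. *)
Lemma pairing_scale (w v : L) : pairing w v *: w = pairing w w *: v.
Proof.
have -> : pairing w v *: w = area w v *: (f *m w) + area w (f *m v) *: (w : 'cV_2).
  rewrite [LHS](_ : _ = form_scale (pairing w v) w) // /form_scale.
  rewrite horner_form_mod rmorphD /= linearZ /= horner_mx_X horner_mx_C.
  by rewrite mulmxDl mul_scalar_mx scalemxAl.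
rewrite pairing_diag form_scale_C.
have coord_eq (u u' : 'cV[R]_2) : u 0 0 = u' 0 0 -> u 1 0 = u' 1 0 -> u = u'.
  move=> eq0 eq1; apply/colP=> i.
  have [->|->] : i = 0 \/ i = 1.
    by case: i => [[|[|]]] // ?; [left|right]; apply: val_inj.
    exact: eq0.
  exact: eq1.
by apply: coord_eq; rewrite /area !(form_mxE, mxE); ring.
Qed.

End FormPairing.

Theorem proposition6p2 (R : comNzRingType) (a b c : R)
    (primitive : forall r : R, exists x y z : R,
       r = a * x + 2 * b * y + c * z) :
  @invertible_module (quad_ring (b ^+ 2 - a * c)) (form_module a b c).
Proof.
have [x [y [z xyz1]]] := primitive 1.
pose e1 : 'cV[R]_2 := delta_mx 0 0; pose e2 : 'cV[R]_2 := delta_mx 1 0.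
pose w (i : 'I_3) : form_module a b c := nth 0 [:: e1; e2; e1 + e2] i.
pose C : R -> quad_ring (form_disc a b c) := qpolyC _.
(* These solve a(x - y) + c(z - y) + (a + 2b + c)y = ax + 2by + cz. *)
pose k (i : 'I_3) := C (nth 0 [:: x - y; z - y; y] i).
apply: (@invertible_of_pairs _ _ 3 k w (fun i => pairingL (w i))) => [i v|].
  exact: pairing_scale.
have CD r s : C r + C s = C (r + s) by rewrite [RHS]qpolyCD.
rewrite !big_ord_recl big_ord0 /= !pairing_diag -!qpolyCM addr0 -/C !CD.
rewrite [RHS](_ : _ = C 1) //; congr C.
by rewrite [RHS]xyz1 /w !mxE /=; ring.
Qed.
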